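(* Let $F$ be a Sturmian set over the alphabet $A$ and let $d\ge1$ be an integer. A bifix code $X\subset F$ is a free basis of a subgroup of index $d$ of the free group $A^\circ$ if and only if $X$ is a finite $F$-maximal bifix code of $F$-degree $d$.
   Context: $A^\circ$ denotes the free group on the finite alphabet $A$, and $A^*$ is viewed as a submonoid of $A^\circ$. A word $u\in F$ is right-special if $ua\in F$ for at least two letters $a$. An infinite word $x$ is episturmian if its set of factors $F(x)$ is closed under reversal and has at most one right-special word of each length; it is strict episturmian if it has exactly one right-special factor of each length and each right-special factor $u$ satisfies $ua\in F(x)$ for all $a\in A$. A Sturmian set is the set of factors of a strict episturmian word. A bifix code is a set of nonempty words none of which is a proper prefix or proper suffix of another; $X\subset F$ is $F$-maximal bifix if not properly contained in a bifix code contained in $F$. A parse of $w$ with respect to $X$ is a triple $(v,x,u)$ with $w=vxu$, $v$ having no suffix in $X$, $x\in X^*$, $u$ having no prefix in $X$; $\delta_X(w)$ is the number of parses and the $F$-degree is $d_F(X)=\max_{w\in F}\delta_X(w)$. *)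

(* Defs.v *)
From mathcomp Require Import all_boot.
Set Implicit Arguments. Unset Strict Implicit. Unset Printing Implicit Defensive.

Section Words.
Variable A : finType.

Definition factor (x : nat -> A) (w : seq A) : Prop :=
  exists i, w = mkseq (fun k => x (i + k)) (size w).

Definition right_special (F : seq A -> Prop) (u : seq A) : Prop :=
  F u /\ exists a b : A, a <> b /\ F (rcons u a) /\ F (rcons u b).

Definition episturmian (x : nat -> A) : Prop :=
  (forall w, factor x w -> factor x (rev w)) /\
  (forall u v, size u = size v -> right_special (factor x) u ->
     right_special (factor x) v -> u = v).

Definition strict_episturmian (x : nat -> A) : Prop :=
  episturmian x /\
  (forall n, exists u, size u = n /\ right_special (factor x) u) /\
  (forall u, right_special (factor x) u -> forall a : A, factor x (rcons u a)).

Definition sturmian_set (F : seq A -> Prop) : Prop :=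
  exists x : nat -> A, strict_episturmian x /\ forall w, F w <-> factor x w.

Definition bifix_code (X : seq A -> Prop) : Prop :=
  (forall w, X w -> w <> [::]) /\
  (forall u v, X u -> X v -> u <> v ->
     ~ (exists t, v = u ++ t) /\ ~ (exists t, v = t ++ u)).

Definition subset_of (X Y : seq A -> Prop) : Prop := forall w, X w -> Y w.

Definition finite_set (X : seq A -> Prop) : Prop :=
  exists s : seq (seq A), forall w, X w <-> w \in s.

Definition F_maximal_bifix (F X : seq A -> Prop) : Prop :=
  bifix_code X /\ subset_of X F /\
  forall Y, bifix_code Y -> subset_of Y F -> subset_of X Y -> subset_of Y X.

Definition star (X : seq A -> Prop) (x : seq A) : Prop :=
  exists l : seq (seq A), (forall y, y \in l -> X y) /\ x = flatten l.

Definition is_parse (X : seq A -> Prop) (w v x u : seq A) : Prop :=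
  w = v ++ x ++ u /\
  (forall s t, v = t ++ s -> ~ X s) /\
  star X x /\
  (forall p t, u = p ++ t -> ~ X p).

Definition num_parses (X : seq A -> Prop) (w : seq A) (n : nat) : Prop :=
  exists s : seq (seq A * seq A * seq A),
    uniq s /\ size s = n /\
    forall v x u, (v, x, u) \in s <-> is_parse X w v x u.

Definition F_degree (F X : seq A -> Prop) (d : nat) : Prop :=
  (exists w, F w /\ num_parses X w d) /\
  (forall w n, F w -> num_parses X w n -> n <= d).

Definition fletter := (A * bool)%type.   (* (a,true) = a, (a,false) = a^-1 *)

Definition finv_letter (l : fletter) : fletter := (l.1, ~~ l.2).

Definition freduce (s : seq fletter) : seq fletter :=
  foldr (fun l acc => match acc with
                      | b :: t => if b == finv_letter l then t else l :: acc
                      | [::] => [:: l] end) [::] s.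

Definition finv (s : seq fletter) : seq fletter := rev (map finv_letter s).

Definition feq (s t : seq fletter) : Prop := freduce s = freduce t.

Definition emb (w : seq A) : seq fletter := map (fun a => (a, true)) w.

Definition sgn_elt (p : seq A * bool) : seq fletter :=
  if p.2 then emb p.1 else finv (emb p.1).

Definition gen_subgroup (X : seq A -> Prop) (g : seq fletter) : Prop :=
  exists l : seq (seq A * bool), (forall p, p \in l -> X p.1) /\
    feq g (flatten (map sgn_elt l)).

Definition xreduced (l : seq (seq A * bool)) : Prop :=
  forall i, i.+1 < size l ->
    ~ ((nth ([::], true) l i).1 = (nth ([::], true) l i.+1).1 /\
       (nth ([::], true) l i).2 = ~~ (nth ([::], true) l i.+1).2).

Definition free_set (X : seq A -> Prop) : Prop :=
  forall l : seq (seq A * bool), (forall p, p \in l -> X p.1) ->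
    xreduced l -> feq (flatten (map sgn_elt l)) [::] -> l = [::].

(* H has index d in A°: exactly d right cosets H r_1, ..., H r_d *)
Definition has_index (H : seq fletter -> Prop) (d : nat) : Prop :=
  exists reps : seq (seq fletter), size reps = d /\
    forall g, exists i, i < d /\ H (g ++ finv (nth [::] reps i)) /\
      forall j, j < d -> H (g ++ finv (nth [::] reps j)) -> j = i.

Definition free_basis_of_index (X : seq A -> Prop) (d : nat) : Prop :=
  free_set X /\ has_index (gen_subgroup X) d.

End Words.

(* Main.v *)
(** Let [H] be the subgroup generated by [X], and for [w] in [F] let [tails X w] be
    the suffixes of [w] with no prefix in [X]; they are in bijection with the parses
    of [w].  The length [n] words of [F] are the vertices of the Rauzy graph, whose
    edges [v -> behead (rcons v b)] are the words of length [n + 1].  In a Sturmian set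
    the possible two-sided extensions of every word form a tree.

    Acyclicity of these trees implies that a labelling of the edges by bijections of
    a set can be changed, by a bijection at each vertex, into one which depends
    only on the letter [b], that is, into an action of the free group.  Applied to
    "append [b], and replace a completed word of [X] by the empty word while recording
    it", this gives an action in which [X] moves a base point as the generators of
    a free group do, and in which distinct tails of [w] move it to distinct places.
    Hence every bifix code [X] in [F] is free, and the tails of [w] lie in distinct
    cosets of [H]; in particular the degree is at most the index.

    If the degree is [d], uniform recurrence makes every long word have [d] tails.
    Reading a letter then permutes the cosets of the tails, and connectedness of the
    extension trees shows that this set of [d] cosets is the same at every
    vertex, hence invariant under [A°], hence the set of all cosets. *)

From mathcomp Require Import all_boot.
From mathcomp Require Import boolp zify.
Require Import Defs.
Set Implicit Arguments. Unset Strict Implicit. Unset Printing Implicit Defensive.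

(** * Reduced words and the free group *)

Section ReducedWords.
Variable B : eqType.
Implicit Types (l : B * bool) (s : seq (B * bool)).

Definition flip l : B * bool := (l.1, ~~ l.2).

Definition push l s : seq (B * bool) :=
  if s is b :: t then if b == flip l then t else l :: s else [:: l].

Fixpoint reduced s : bool :=
  if s is l :: t then (if t is b :: _ then b != flip l else true) && reduced t
  else true.

Lemma flipK : involutive flip.
Proof. by case=> b e; rewrite /flip /= negbK. Qed.

Lemma push_reduced l s : reduced s -> reduced (push l s).
Proof.
case: s => [//|b t] /= /andP[h ht]; case: ifP => [//|/negbT hb] /=.
by rewrite hb h ht.
Qed.

Lemma pushK l s : reduced s -> push (flip l) (push l s) = s.
Proof.
case: s => [_|b t] /=; first by rewrite flipK eqxx.
move=> /andP[h ht]; case: ifP => [/eqP eb|_] /=; last by rewrite flipK eqxx.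
by case: t h ht => [|c t] /= h _; rewrite ?eb //; move: h; rewrite eb => /negbTE ->.
Qed.

Lemma pushVK l s : reduced s -> push l (push (flip l) s) = s.
Proof. by move=> rs; rewrite -{1}(flipK l) pushK. Qed.

Lemma push_reducedE l s : reduced (l :: s) -> push l s = l :: s.
Proof. by case: s => [//|b t] /= /andP[/negbTE ->]. Qed.

(** A model of the free group on [B]: on reduced sequences, pushing a letter is a bijection. [B] is
    arbitrary because letters of [A] and words of the code both serve as generators. *)
Definition rword := {s | reduced s}.

Definition rnil : rword := exist _ [::] isT.

Definition rpush l (s : rword) : rword :=
  exist _ (push l (val s)) (push_reduced l (valP s)).

Lemma rpushK l : cancel (rpush l) (rpush (flip l)).
Proof. by move=> s; apply: val_inj; rewrite /= pushK // (valP s). Qed.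

Lemma rpushVK l : cancel (rpush (flip l)) (rpush l).
Proof. by move=> s; rewrite -{2}(rpushK (flip l) s) flipK. Qed.

Lemma foldl_rpush_rev s (k : rword) :
  reduced (rev s ++ val k) ->
  val (foldl (fun r l => rpush l r) k s) = rev s ++ val k.
Proof.
elim: s k => [//|l s IH] k; rewrite rev_cons cat_rcons => red /=.
have redl : reduced (l :: val k).
  by elim: (rev s) red => [//|b r IHr] /= /andP[_ /IHr].
by rewrite IH /= push_reducedE.
Qed.

End ReducedWords.

Section FreeGroup.
Variable A : finType.
Implicit Types (s t g h : seq (fletter A)) (u v w : seq A).

Lemma freduceE s : freduce s = foldr (@push A) [::] s.
Proof. by []. Qed.

Lemma freduce_reduced s : reduced (freduce s).
Proof. by elim: s => [//|l s IH]; apply: push_reduced. Qed.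

Lemma foldr_push_reduced s t : reduced t -> reduced (foldr (@push A) t s).
Proof. by move=> rt; elim: s => [//|l s IH]; apply: push_reduced. Qed.

(** On reduced sequences, pushing a letter and then its inverse is the identity, so cancellations in
    [s] do not affect the result. This makes [feq] a congruence. *)
Lemma foldr_push_freduce s t : reduced t ->
  foldr (@push A) t (freduce s) = foldr (@push A) t s.
Proof.
move=> rt; elim: s => [//|l s IH]; rewrite [RHS]/= -IH.
rewrite -[freduce (l :: s)]/(push l (freduce s)).
case: (freduce s) => [//|b r] /=; case: ifP => // /eqP ->.
by rewrite /= pushVK // foldr_push_reduced.
Qed.

Lemma freduce_cat s t : freduce (s ++ t) = foldr (@push A) (freduce t) s.
Proof. by rewrite !freduceE foldr_cat. Qed.

Lemma feq_cat s s' t t' : feq s s' -> feq t t' -> feq (s ++ t) (s' ++ t').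
Proof.
rewrite /feq !freduce_cat => es ->.
by rewrite -(foldr_push_freduce s) ?freduce_reduced // es foldr_push_freduce
     ?freduce_reduced.
Qed.

Lemma feq_catl s t t' : feq t t' -> feq (s ++ t) (s ++ t').
Proof. exact: feq_cat. Qed.

Lemma feq_catr s s' t : feq s s' -> feq (s ++ t) (s' ++ t).
Proof. by move=> h; apply: feq_cat. Qed.

Lemma finvK s : finv (finv s) = s.
Proof.
by rewrite /finv map_rev revK -map_comp map_id_in // => l _; apply: flipK.
Qed.

Lemma finv_cat s t : finv (s ++ t) = finv t ++ finv s.
Proof. by rewrite /finv map_cat rev_cat. Qed.

Lemma feq_invl s : feq (finv s ++ s) [::].
Proof.
elim: s => [//|l s IH]; rewrite -cat1s finv_cat -catA.
apply: etrans IH; apply: feq_catl.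
by rewrite /feq catA freduce_cat /= pushK ?freduce_reduced.
Qed.

Lemma feq_invr s : feq (s ++ finv s) [::].
Proof. by rewrite -{1}(finvK s); apply: feq_invl. Qed.

Lemma feq_invKl s t : feq (finv s ++ s ++ t) t.
Proof. by rewrite catA; apply: etrans (feq_catr t (feq_invl s)) _. Qed.

Lemma feq_invKr s t : feq (s ++ finv s ++ t) t.
Proof. by rewrite catA; apply: etrans (feq_catr t (feq_invr s)) _. Qed.

Lemma feq_finv s t : feq s t -> feq (finv s) (finv t).
Proof.
move=> st; apply: etrans (feq_invKl s (finv t)).
rewrite -{1}(cats0 (finv s)); apply: feq_catl.
by apply: etrans (esym (feq_invr t)) _; apply: feq_catr.
Qed.

Lemma emb_rcons u b : emb (rcons u b) = rcons (emb u) (b, true).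
Proof. exact: map_rcons. Qed.

(** * Actions of the free group *)

Section Action.
Variables (T : Type) (act : fletter A -> T -> T).
Hypothesis actK : forall l, cancel (act l) (act (finv_letter l)).

Definition actw (z : T) s : T := foldl (fun z l => act l z) z s.

Lemma actw_cat z s t : actw z (s ++ t) = actw (actw z s) t.
Proof. exact: foldl_cat. Qed.

Lemma actw_freduce z s : actw z (freduce s) = actw z s.
Proof.
elim: s z => [//|l s IH] z; rewrite [RHS]/= -IH.
rewrite -[freduce (l :: s)]/(push l (freduce s)).
by case: (freduce s) => [//|b r] /=; case: ifP => // /eqP ->; rewrite actK.
Qed.

Lemma actw_feq z s t : feq s t -> actw z s = actw z t.
Proof. by move=> h; rewrite -actw_freduce h actw_freduce. Qed.

Lemma actwK z s : actw (actw z s) (finv s) = z.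
Proof. by rewrite -actw_cat (actw_feq _ (feq_invr s)). Qed.

End Action.

(** * Generated subgroups, cosets and index *)

Section Subgroup.
Variable X : seq A -> Prop.
Notation H := (gen_subgroup X).

Lemma gen_feq g h : feq g h -> H g -> H h.
Proof. by move=> gh [l [lX e]]; exists l; split=> //; rewrite /feq -gh. Qed.

Lemma gen1 : H [::].
Proof. by exists [::]. Qed.

Lemma gen_mul g h : H g -> H h -> H (g ++ h).
Proof.
move=> [l [lX el]] [m [mX em]]; exists (l ++ m); split.
  by move=> p; rewrite mem_cat => /orP[/lX|/mX].
by rewrite map_cat flatten_cat; apply: feq_cat.
Qed.

Lemma gen_inv g : H g -> H (finv g).
Proof.
move=> [l [lX el]]; exists (rev [seq (p.1, ~~ p.2) | p <- l]); split.
  by move=> p; rewrite mem_rev => /mapP[p' /lX + ->].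
apply: etrans (feq_finv el) _; congr freduce.
elim: l {lX el} => [//|[x e] l IH].
rewrite /= finv_cat IH rev_cons map_rcons flatten_rcons; congr (_ ++ _).
by case: e; rewrite /sgn_elt /= ?finvK.
Qed.

Lemma gen_emb x : X x -> H (emb x).
Proof.
by move=> Xx; exists [:: (x, true)]; split=> [p|]; rewrite ?inE /= ?cats0 // => /eqP ->.
Qed.

Lemma gen_coset_trans g h r :
  H (g ++ finv r) -> H (h ++ finv r) -> H (g ++ finv h).
Proof.
move=> gr hr; apply: gen_feq (gen_mul gr (gen_inv hr)).
by rewrite finv_cat finvK -catA; apply/feq_catl/feq_invKl.
Qed.

Lemma gen_coset_sym g h : H (g ++ finv h) -> H (h ++ finv g).
Proof. by move/gen_inv; rewrite finv_cat finvK. Qed.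

(** Sending each representative of the first list to the one of its coset in the second list is
    injective: two with the same image share a coset. *)
Lemma has_index_le d d' : has_index H d -> has_index H d' -> d <= d'.
Proof.
move=> [R [_ RP]] [R' [_ RP']].
have [f fP] := choice (fun i => RP' (nth [::] R i)).
suff : uniq (map f (iota 0 d)).
  move/uniq_leq_size => /(_ (iota 0 d')); rewrite size_map !size_iota; apply.
  by move=> j /mapP[i _ ->]; rewrite mem_iota; case: (fP i).
rewrite map_inj_in_uniq ?iota_uniq // => i j; rewrite !mem_iota /= => ltid ltjd fij.
have [_ [hi _]] := fP i; have [_ [hj _]] := fP j.
have [i0 [_ [_ i0P]]] := RP (nth [::] R i).
transitivity i0; [apply: i0P ltid _ | symmetry; apply: i0P ltjd _].
  by apply: gen_feq gen1; symmetry; apply: feq_invr.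
by rewrite -fij in hj; apply: gen_coset_trans hi hj.
Qed.

End Subgroup.

End FreeGroup.

(** * Parses *)

Section Parses.
Variables (A : finType) (X : seq A -> Prop).
Implicit Types (u v w t x y p s : seq A).

Lemma cat_suffix_total t u t' v : t ++ u = t' ++ v ->
  (exists s, v = s ++ u) \/ (exists s, u = s ++ v).
Proof.
elim: t t' => [|a t IH] [|b t'] /=.
- by move=> ->; left; exists [::].
- by move=> ->; right; exists (b :: t').
- by move=> <-; left; exists (a :: t).
- by case=> _; apply: IH.
Qed.

Lemma catIs s u v : u ++ s = v ++ s -> u = v.
Proof.
move=> e; have es : size u = size v.
  by have /(congr1 size) := e; rewrite !size_cat; lia.
by move/eqP: e; rewrite eqseq_cat // eqxx andbT => /eqP.
Qed.

Hypothesis bX : bifix_code X.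

Lemma code_nonempty : ~ X [::].
Proof. by case: bX => h _ /h. Qed.

Lemma code_suffix_inj x y t t' : X x -> X y -> t ++ x = t' ++ y -> x = y.
Proof.
move=> Xx Xy /cat_suffix_total h; apply: contrapT => ne.
case: bX => _ bX2; case: h => [hs|hs]; first by case: (bX2 _ _ Xx Xy ne) => _.
by case: (bX2 _ _ Xy Xx (not_eq_sym ne)) => _.
Qed.

Lemma code_prefix_free x y t : X x -> X y -> y = x ++ t -> x = y.
Proof.
move=> Xx Xy e; apply: contrapT => ne; case: bX => _ bX2.
by case: (bX2 _ _ Xx Xy ne) => + _; apply; exists t.
Qed.

Definition avoids_prefix u : bool := `[< forall p t, u = p ++ t -> ~ X p >].

(** The empty suffix is kept without a test: its only prefix is itself, which is not a code word. *)
Fixpoint tails w : seq (seq A) :=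
  if w is _ :: w' then if avoids_prefix w then w :: tails w' else tails w'
  else [:: [::]].

Lemma avoids_prefix_nil : avoids_prefix [::].
Proof. by apply/asboolP => -[|//] t _; apply: code_nonempty. Qed.

Lemma avoids_prefix_catl u t : avoids_prefix (u ++ t) -> avoids_prefix u.
Proof.
by move=> /asboolP h; apply/asboolP => p s e; apply: (h p (s ++ t)); rewrite e catA.
Qed.

Lemma avoids_prefix_rcons u b :
  avoids_prefix u -> ~ X (rcons u b) -> avoids_prefix (rcons u b).
Proof.
move=> /asboolP h nX; apply/asboolP => p t.
case/lastP: t => [|t c]; first by rewrite cats0 => <-.
by rewrite -rcons_cat => /rcons_inj[e _]; apply: h e.
Qed.

Lemma avoids_prefix_code u b : X (rcons u b) -> avoids_prefix u.
Proof.
move=> Xub; apply/asboolP => p t e Xp.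
have ep : rcons u b = p ++ rcons t b by rewrite e rcons_cat.
have := code_prefix_free Xp Xub ep; rewrite ep => /(congr1 size).
by rewrite size_cat size_rcons; lia.
Qed.

Lemma mem_tails w u : reflect ((exists t, w = t ++ u) /\ avoids_prefix u) (u \in tails w).
Proof.
elim: w => [|a w IH] /=.
  rewrite inE; apply: (iffP eqP) => [->|[[t]]]; last by case: t => //= <-.
  by split; [exists [::] | apply: avoids_prefix_nil].
have -> : (u \in (if avoids_prefix (a :: w) then (a :: w) :: tails w else tails w)) =
          ((u == a :: w) && avoids_prefix u) || (u \in tails w).
  by case: ifP => h; rewrite ?inE; case: eqP => [->|//]; rewrite h.
apply: (iffP orP) => [[/andP[/eqP -> h]|/IH[[t ->] h]]|[[[|b t] e] h]].
- by split=> //; exists [::].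
- by split=> //; exists (a :: t).
- by left; rewrite h andbT e.
- by case: e => _ e; right; apply/IH; split=> //; exists t.
Qed.

Lemma tails_size w u : u \in tails w -> size u <= size w.
Proof. by move=> /mem_tails[[t ->] _]; rewrite size_cat leq_addl. Qed.

Lemma tails_uniq w : uniq (tails w).
Proof.
elim: w => [//|a w IH] /=; case: ifP => //= _; rewrite IH andbT.
by apply/negP => /tails_size /=; rewrite ltnn.
Qed.

Lemma nil_in_tails w : [::] \in tails w.
Proof. by apply/mem_tails; split; [exists w; rewrite cats0 | apply: avoids_prefix_nil]. Qed.

Lemma tails_catl t w u : u \in tails w -> u \in tails (t ++ w).
Proof.
move=> /mem_tails[[s ->] h]; apply/mem_tails.
by split=> //; exists (t ++ s); rewrite catA.
Qed.

Lemma tails_rcons w u b :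
  u \in tails w -> ~ X (rcons u b) -> rcons u b \in tails (rcons w b).
Proof.
move=> /mem_tails[[s ->] h] nX; apply/mem_tails.
by split; [exists s; rewrite rcons_cat | apply: avoids_prefix_rcons].
Qed.

Lemma tails_rcons_inv w u b : rcons u b \in tails (rcons w b) -> u \in tails w.
Proof.
move=> /mem_tails[[s e] h]; apply/mem_tails; split.
  by exists s; move: e; rewrite -rcons_cat => /rcons_inj[].
by rewrite -cats1 in h; apply: avoids_prefix_catl h.
Qed.

Lemma size_tails_catl t w : size (tails w) <= size (tails (t ++ w)).
Proof. by apply: (uniq_leq_size (tails_uniq w)) => u; apply: tails_catl. Qed.

(** Append [b] to each tail and restart at the empty word when this completes a code word. At most
    one tail is completed, since no code word is a proper suffix of another, so the map is
    injective. *)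
Lemma size_tails_rcons w b : size (tails w) <= size (tails (rcons w b)).
Proof.
pose f u := if `[< X (rcons u b) >] then [::] else rcons u b.
rewrite -(size_map f); apply: uniq_leq_size => [|_ /mapP[u uw ->]]; last first.
  rewrite /f; case: asboolP => h; first exact: nil_in_tails.
  exact: tails_rcons.
rewrite map_inj_in_uniq ?tails_uniq // => u v /mem_tails[[s e] _] /mem_tails[[s' e'] _].
rewrite /f; case: asboolP => hu; case: asboolP => hv.
- move=> _; have /rcons_inj[] // : rcons u b = rcons v b.
  by apply: (code_suffix_inj (t := s) (t' := s') hu hv); rewrite -!rcons_cat -e -e'.
- by move/(congr1 size); rewrite size_rcons.
- by move/(congr1 size); rewrite size_rcons.
- by move/rcons_inj => [].
Qed.

Lemma size_tails_catr w t : size (tails w) <= size (tails (w ++ t)).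
Proof.
elim/last_ind: t => [|t b IH]; first by rewrite cats0.
by rewrite -rcons_cat; apply: leq_trans IH (size_tails_rcons _ _).
Qed.

Lemma size_tails_ltn w b : (forall u, u \in tails w -> ~ X (rcons u b)) ->
  size (tails w) < size (tails (rcons w b)).
Proof.
move=> h; rewrite -(size_map (rcons^~ b)).
apply: (@uniq_leq_size _ ([::] :: [seq rcons u b | u <- tails w])) => [|v] /=.
  rewrite map_inj_uniq ?tails_uniq ?andbT => [|u v /rcons_inj[]//].
  by apply/mapP => -[u _ /(congr1 size)]; rewrite size_rcons.
rewrite inE => /orP[/eqP ->|/mapP[u uw ->]]; first exact: nil_in_tails.
by apply: tails_rcons => //; apply: h.
Qed.

Definition avoids_suffix v := forall s t, v = t ++ s -> ~ X s.

(** Code words are stripped from the right end as long as possible. *)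
Lemma parse_left_exists z : exists vx : seq A * seq A,
  z = vx.1 ++ vx.2 /\ avoids_suffix vx.1 /\ star X vx.2.
Proof.
have [n] := ubnP (size z); elim: n z => // n IH z /ltnSE-lez.
case: (EM (avoids_suffix z)) => [h|].
  by exists (z, [::]); rewrite cats0; split=> //; split=> //; exists [::].
move=> /existsNP[s /existsNP[t /not_implyP[e /contrapT Xs]]].
have [|[v x] /= [et [hv [l [lX ex]]]]] := IH t.
  apply: leq_trans lez; rewrite e size_cat -[ltnLHS]addn0 ltn_add2l.
  by case: s Xs {e} => // /code_nonempty.
exists (v, x ++ s); split=> /=; first by rewrite e et catA.
split=> //; exists (rcons l s); rewrite ex flatten_rcons; split=> // y.
by rewrite mem_rcons inE => /orP[/eqP ->|/lX].
Qed.

Lemma parse_left_uniq v x v' x' : avoids_suffix v -> avoids_suffix v' ->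
  star X x -> star X x' -> v ++ x = v' ++ x' -> v = v'.
Proof.
move=> hv hv' [l [lX ->]] [l' [l'X ->]] {x x'}.
elim/last_ind: l l' lX l'X => [|l y IH] l'; case/lastP: l' => [|l' y'] lX l'X.
- by rewrite !cats0.
- rewrite flatten_rcons cats0 catA => e; case: (hv _ _ e).
  by apply: l'X; rewrite mem_rcons mem_head.
- rewrite flatten_rcons cats0 catA => e; case: (hv' _ _ (esym e)).
  by apply: lX; rewrite mem_rcons mem_head.
rewrite !flatten_rcons !catA => e.
have Xy : X y by apply: lX; rewrite mem_rcons mem_head.
have Xy' : X y' by apply: l'X; rewrite mem_rcons mem_head.
have ey := code_suffix_inj Xy Xy' e; rewrite -ey in e.
apply: (IH l'); last exact: catIs e.
- by move=> z zl; apply: lX; rewrite mem_rcons inE zl orbT.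
- by move=> z zl; apply: l'X; rewrite mem_rcons inE zl orbT.
Qed.

(** A parse is determined by its last component, because what precedes it splits uniquely. *)
Lemma num_parsesE w n : num_parses X w n <-> n = size (tails w).
Proof.
have fex u : exists p : seq A * seq A, u \in tails w -> is_parse X w p.1 p.2 u.
  case: (boolP (u \in tails w)) => [|_]; last by exists ([::], [::]).
  move=> /mem_tails[[z ez] /asboolP hu].
  have [vx [e [hv sx]]] := parse_left_exists z.
  by exists vx => _; split=> //; rewrite ez e catA.
have [f fP] := choice fex.
pose s0 := [seq ((f u).1, (f u).2, u) | u <- tails w].
have s0_uniq : uniq s0 by rewrite map_inj_uniq ?tails_uniq // => u v [].
have s0P v x u : (v, x, u) \in s0 <-> is_parse X w v x u.
  split=> [/mapP[u' u'w [-> -> ->]]|[ew [hv [hx hu]]]]; first exact: fP.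
  have uw : u \in tails w.
    by apply/mem_tails; split; [exists (v ++ x); rewrite -catA | apply/asboolP].
  have [ew' [hv' [hx' _]]] := fP _ uw.
  have e : v ++ x = (f u).1 ++ (f u).2.
    by apply: (@catIs u); rewrite -!catA -ew -ew'.
  have ev := parse_left_uniq hv hv' hx hx' e.
  have ex : x = (f u).2.
    by move: e; rewrite -ev => /eqP; rewrite eqseq_cat // eqxx => /eqP.
  by apply/mapP; exists u; rewrite // -ev -ex.
split=> [[s [us [<- sP]]]|->]; last by exists s0; rewrite size_map.
rewrite -(size_map (fun u => ((f u).1, (f u).2, u))) -/s0.
apply/eqP; rewrite eqn_leq !uniq_leq_size // => -[[v x] u] /=.
  by move/s0P/sP.
by move/sP/s0P.
Qed.

End Parses.

(** * Strict episturmian words *)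

Section Episturmian.
Variables (A : finType) (x : nat -> A).
Implicit Types (u v w p s : seq A) (a b : A).
Notation F := (factor x).

Definition window i n : seq A := mkseq (fun k => x (i + k)) n.

Lemma size_window i n : size (window i n) = n.
Proof. exact: size_mkseq. Qed.

Lemma window_cat i m n : window i (m + n) = window i m ++ window (i + m) n.
Proof.
rewrite /window /mkseq iotaD map_cat add0n -{2}(addn0 m) iotaDl -map_comp.
by congr (_ ++ _); apply: eq_map => k /=; rewrite addnA.
Qed.

Lemma windowS i n : window i n.+1 = rcons (window i n) (x (i + n)).
Proof. by rewrite -addn1 window_cat -cats1 /window /mkseq /= addn0. Qed.

Lemma factor_window i n : F (window i n).
Proof. by exists i; rewrite size_window. Qed.

Lemma window_catE i u v w : window i (size (u ++ v ++ w)) = u ++ v ++ w ->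
  window (i + size u) (size v) = v.
Proof.
rewrite !size_cat !window_cat => /eqP.
by rewrite eqseq_cat ?size_window // eqseq_cat ?size_window // => /and3P[_ /eqP].
Qed.

Lemma factor_infix u v w : F (u ++ v ++ w) -> F v.
Proof. by move=> [i /esym /window_catE <-]; apply: factor_window. Qed.

Lemma factor_catl u v : F (u ++ v) -> F v.
Proof. by rewrite -{1}(cats0 v); apply: factor_infix. Qed.

Lemma factor_catr u v : F (u ++ v) -> F u.
Proof. exact: (@factor_infix [::]). Qed.

Lemma factor_rcons u b : F (rcons u b) -> F u.
Proof. by rewrite -cats1; apply: factor_catr. Qed.

Lemma factor_right_ext w : F w -> exists b, F (rcons w b).
Proof. by move=> [i ->]; exists (x (i + size w)); rewrite -windowS; apply: factor_window. Qed.

Hypothesis ex : strict_episturmian x.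

Lemma factor_rev w : F w -> F (rev w).
Proof. by case: ex => -[h _] _; apply: h. Qed.

Lemma factor_left_ext w : F w -> exists a, F (a :: w).
Proof.
move=> /factor_rev /factor_right_ext[a /factor_rev].
by rewrite rev_rcons revK; exists a.
Qed.

(* The reversal of a long prefix of [x] containing [w] carries [rev w] far to the right. *)
Lemma recurrence w m : F w -> exists2 i, m <= i & window i (size w) = w.
Proof.
suff rec u : F u -> exists2 i, m <= i & window i (size u) = rev u.
  by move=> /factor_rev /rec; rewrite size_rev revK.
move=> [i eu].
have [j] := factor_rev (factor_window 0 (i + (size u + m))).
rewrite !window_cat !rev_cat add0n -[window i (size u)]/(mkseq _ _) -eu => /esym e.
exists (j + m); first exact: leq_addl.
have := @window_catE j (rev (window (i + size u) m)) (rev u) (rev (window 0 i)).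
by rewrite !size_rev size_window; apply; rewrite catA.
Qed.

Lemma right_special_uniq u v : size u = size v ->
  right_special F u -> right_special F v -> u = v.
Proof. by case: ex => -[_ h] _; apply: h. Qed.

Lemma right_special_ext w : right_special F w -> exists a, forall b, F (a :: rcons w b).
Proof.
move=> rw; case: ex => _ [/(_ (size w).+1)[v [sv rv]] full].
case: v sv rv => [//|a v] [sv] rv.
have vw : v = w.
  apply: right_special_uniq => //; case: rv => Fv [b [c [bc [Fb Fc]]]].
  split; first exact: (@factor_catl [:: a]).
  by exists b, c; do !split=> //; exact: (@factor_catl [:: a]).
by exists a => b; rewrite -vw; apply: full rv b.
Qed.

(** The extension graph is connected through [b0] and acyclic because all other edges leave [a0]. If
    [w] is not right-special, [b0] is its only right extension; if it is not left-special, [a0] is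
    its only left extension. If it is both, an edge avoiding [a0] and [b0] would give a second
    right-special word of the length of [a0 :: w]. *)
Lemma extension_tree w : F w -> exists a0 b0,
  (forall a, F (a :: w) -> F (a :: rcons w b0)) /\
  (forall a b, F (a :: rcons w b) -> a = a0 \/ b = b0).
Proof.
move=> Fw; have Frw := factor_rev Fw.
case: (EM (right_special F w)) => [rw|nrw]; last first.
  have [b0 Fb0] := factor_right_ext Fw; have [a0 _] := factor_left_ext Fw.
  have ub b : F (rcons w b) -> b = b0.
    move=> Fb; apply: contrapT => ne; apply: nrw; split=> //.
    by exists b, b0.
  exists a0, b0; split=> [a /factor_right_ext[b Fab]|a b Fab]; last first.
    by right; apply/ub/(@factor_catl [:: a]).
  by rewrite -(ub b) //; apply: (@factor_catl [:: a]).
have [a0 a0P] := right_special_ext rw.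
case: (EM (right_special F (rev w))) => [lw|nlw]; last first.
  have [b0 _] := factor_right_ext Fw.
  have ua a : F (a :: w) -> a = a0.
    move=> Fa; apply: contrapT => ne; apply: nlw; split=> //.
    exists a, a0; rewrite -!rev_cons; split=> //; split; apply: factor_rev => //.
    exact: (@factor_rcons (a0 :: w) b0 (a0P b0)).
  exists a0, b0; split=> [a /ua -> //|a b Fab]; left; apply: ua.
  exact: (@factor_rcons (a :: w) b Fab).
have [b0 b0P] := right_special_ext lw.
have b0F a : F (a :: rcons w b0).
  by have := factor_rev (b0P a); rewrite rev_cons rev_rcons revK rcons_cons.
exists a0, b0; split=> [a _ //|a b Fab].
apply: contrapT => /not_orP[nea neb].
have r1 : right_special F (a0 :: w).
  split; first exact: (@factor_rcons (a0 :: w) b (a0P b)).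
  by exists b, b0; split=> //; split; exact: a0P.
have r2 : right_special F (a :: w).
  split; first exact: (@factor_rcons (a :: w) b Fab).
  by exists b, b0; split=> //; split; [exact: Fab | exact: b0F].
by have [/nea] := right_special_uniq (erefl : size (a :: w) = size (a0 :: w)) r2 r1.
Qed.

Lemma right_special_exists n : exists2 u, size u = n & right_special F u.
Proof. by case: ex => _ [/(_ n)[u [su ru]] _]; exists u. Qed.

(* Otherwise two occurrences of [w] would continue identically for ever, making
   [x] ultimately periodic, which contradicts long right-special words. *)
Lemma right_special_completion w : F w -> exists y, right_special F (w ++ y).
Proof.
move=> Fw; apply: contrapT => /forallNP nrs.
have [i _ ei] := recurrence 0 Fw.
have [j ltij ej] := recurrence i.+1 Fw.
have same n : window i (size w + n) = window j (size w + n).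
  elim: n => [|n IH]; first by rewrite addn0 ei ej.
  rewrite addnS !windowS IH; congr rcons; apply: contrapT => ne.
  apply: (nrs (window (j + size w) n)); split.
    by rewrite -{1}ej -window_cat; apply: factor_window.
  rewrite -{1 3}ej -window_cat; exists (x (i + (size w + n))), (x (j + (size w + n))).
  by split=> //; split; [rewrite -IH|]; rewrite -windowS; apply: factor_window.
have per k : i <= k -> x (k + (j - i)) = x k.
  move=> ik; have := congr1 (nth (x 0) ^~ (k - i)) (same (k - i).+1).
  rewrite !nth_mkseq; try lia.
  by rewrite subnKC // => ->; congr x; lia.
(* With period [j - i], a factor of length [j - i + 1] ends with its own first letter, so [r] has
   only one right extension. *)
have [r sr [_ [b [c [bc [Fb Fc]]]]]] := right_special_exists (j - i).
have lastE d : F (rcons r d) -> d = head d r.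
  move=> Fd; have [k ik ek] := recurrence i Fd; move: ek; rewrite size_rcons sr windowS.
  move=> /rcons_inj[<- <-]; rewrite per //.
  by have : 0 < j - i; [lia | case: (j - i) => //= n _; rewrite addn0].
apply: bc; rewrite (lastE _ Fb) (lastE _ Fc); case: (r) sr => //= sr.
by move: ltij; lia.
Qed.

(** As long as [r] is not met, the next letter is forced, so every occurrence of [v] follows the one
    at [i0], which reaches [r] at [j0]. *)
Lemma right_special_gap r v : right_special F r -> F v -> size v = size r ->
  exists B, forall i, window i (size r) = v ->
    exists2 j, i <= j <= i + B & window j (size r) = r.
Proof.
move=> rr Fv sv; have [i0 _ ei0] := recurrence 0 Fv.
have [j0 le_ij ej0] := recurrence i0 rr.1; rewrite sv in ei0.
exists (j0 - i0) => i ei.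
suff h n : (exists2 j, i <= j <= i + n & window j (size r) = r) \/
           window (i + n) (size r) = window (i0 + n) (size r).
  case: (h (j0 - i0)) => // e; exists (i + (j0 - i0)); first by rewrite leq_addr leqnn.
  by rewrite e subnKC.
elim: n => [|n [[j ij ej]|IH]]; first by right; rewrite !addn0 ei ei0.
  by left; exists j => //; lia.
case: (EM (window (i + n) (size r) = r)) => [e|ne].
  by left; exists (i + n) => //; lia.
right; set m := size r in IH ne *.
have ex1 : x (i + n + m) = x (i0 + n + m).
  apply: contrapT => nx; apply: ne; apply: (right_special_uniq _ _ rr); first exact: size_window.
  split; first exact: factor_window.
  exists (x (i + n + m)), (x (i0 + n + m)); split=> //.
  by split; last rewrite IH; rewrite -windowS; apply: factor_window.
have := congr1 (rcons^~ (x (i + n + m))) IH; rewrite /= {2}ex1 -!windowS.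
rewrite -[m.+1]add1n !window_cat !addn1 -!addnS => /eqP.
by rewrite eqseq_cat ?size_window // => /andP[_ /eqP].
Qed.

(** Complete [w] to a right-special [r] and add up the gap bounds for the finitely many words of
    length [size r]. *)
Lemma uniform_recurrence w : F w ->
  exists N, forall v, F v -> N <= size v -> exists p s, v = p ++ w ++ s.
Proof.
move=> /right_special_completion[y rr]; set r := w ++ y in rr; set m := size r.
have [B BP] : exists B, forall i, exists2 j, i <= j <= i + B & window j m = r.
  have bound (l : seq (seq A)) : exists B, forall v, v \in l -> F v -> size v = m ->
      forall i, window i m = v -> exists2 j, i <= j <= i + B & window j m = r.
    elim: l => [|v l [B BP]]; first by exists 0.
    case: (EM (F v /\ size v = m)) => [[Fv sv]|nv]; last first.
      by exists B => u; rewrite inE => /orP[/eqP -> Fu su|/BP//]; case: nv.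
    have [B' B'P] := right_special_gap rr Fv sv.
    exists (B + B') => u; rewrite inE => /orP[/eqP -> _ _ i /B'P|/BP h Fu su i /(h Fu su)].
      by case=> j ij ej; exists j => //; lia.
    by case=> j ij ej; exists j => //; lia.
  have [B BP] := bound [seq val t | t : m.-tuple A]; exists B => i.
  apply: (BP (window i m)) => //; [|exact: factor_window|exact: size_window].
  have sw : size (window i m) == m by rewrite size_window.
  by apply/mapP; exists (Tuple sw); rewrite ?mem_enum.
exists (B + m) => v [i ev] sv; have [j ij ej] := BP i.
exists (window i (j - i)), (y ++ window (j + m) (size v - (j - i) - m)).
rewrite {1}ev -[mkseq _ _]/(window i (size v)).
rewrite {1}(_ : size v = (j - i) + (m + (size v - (j - i) - m))); last lia.
by rewrite !window_cat subnKC ?ej -?catA //; lia.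
Qed.

End Episturmian.

(** * Labellings of Rauzy graphs *)

Section Rauzy.
Variables (A : finType) (F : seq A -> Prop).
Implicit Types (u v w : seq A) (a b : A).

Hypothesis F_nil : F [::].
Hypothesis F_letter : forall b, F [:: b].
Hypothesis F_infix : forall u v w, F (u ++ v ++ w) -> F v.
Hypothesis F_left : forall w, F w -> exists a, F (a :: w).
Hypothesis F_tree : forall w, F w -> exists a0 b0,
  (forall a, F (a :: w) -> F (a :: rcons w b0)) /\
  (forall a b, F (a :: rcons w b) -> a = a0 \/ b = b0).

Lemma F_cons a w : F (a :: w) -> F w.
Proof. by rewrite -{1}(cats0 w) -cat1s; apply: F_infix. Qed.

Lemma F_rcons w b : F (rcons w b) -> F w.
Proof. by rewrite -cats1; apply: (@F_infix [::]). Qed.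

Lemma F_extend_left n w : F w -> exists2 z, size z = n & F (z ++ w).
Proof.
move=> Fw; elim: n => [|n [z sz /F_left[a Fa]]]; first by exists [::].
by exists (a :: z); rewrite //= sz.
Qed.

(* The edges leaving [a :: w] and entering [rcons w b] are indexed by the
   extension tree of [w]; contracting these trees one length at a time makes the
   labels depend on the last letter only. *)
Lemma gauge (T : Type) n (tau tau' : seq A -> A -> T -> T) :
  (forall v b, cancel (tau v b) (tau' v b)) ->
  (forall v b, cancel (tau' v b) (tau v b)) ->
  exists (th : seq A -> T -> T) (rho rho' : A -> T -> T),
    [/\ forall v, injective (th v),
        forall b, cancel (rho b) (rho' b),
        forall b, cancel (rho' b) (rho b) &
        forall v b z, size v = n -> F (rcons v b) ->
          th (behead (rcons v b)) (tau v b z) = rho b (th v z)].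
Proof.
elim: n tau tau' => [|n IH] tau tau' tauK tauVK.
  exists (fun _ => id), (tau [::]), (tau' [::]).
  by split=> // -[|//] b z.
have [c cP] : {c : seq A -> A * A & forall w, F w ->
    forall a b, F (a :: rcons w b) -> a = (c w).1 \/ b = (c w).2}.
  pose P w (c : A * A) := F w -> forall a b, F (a :: rcons w b) -> a = c.1 \/ b = c.2.
  apply: (@choice _ _ P) => w; rewrite /P.
  case: (EM (F w)) => [/F_tree[a0 [b0 [_ h]]]|nFw]; first by exists (a0, b0).
  by have [a _] := F_left F_nil; exists (a, a).
(* The change at [a :: w] which gives all edges from left extensions of [w] along [b0] the same
   label; it is the identity at [a0 :: w]. Here [c w] is the pair of [a0] and [b0]. *)
pose alpha v z := if v is a :: w then
  tau' ((c w).1 :: w) (c w).2 (tau v (c w).2 z) else z.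
pose alpha' v z := if v is a :: w then
  tau' v (c w).2 (tau ((c w).1 :: w) (c w).2 z) else z.
have alphaK v : cancel (alpha v) (alpha' v).
  by case: v => [|a w] z //=; rewrite tauVK tauK.
have alphaVK v : cancel (alpha' v) (alpha v).
  by case: v => [|a w] z //=; rewrite tauVK tauK.
pose beta w b := tau ((c w).1 :: w) b.
have [||th [rho [rho' [thI rhoK rhoVK thP]]]] :=
  IH (fun w b z => alpha (rcons w b) (beta w b z))
     (fun w b z => tau' ((c w).1 :: w) b (alpha' (rcons w b) z)).
- by move=> w b z; rewrite alphaK tauK.
- by move=> w b z; rewrite /beta tauVK alphaVK.
exists (fun v z => th (behead v) (alpha v z)), rho, rho'; split=> //.
  by move=> v y z /thI /(can_inj (alphaK v)).
move=> [//|a w] b z [sw] Fawb; rewrite /= -thP //; last exact: F_cons Fawb.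
(* Acyclicity: either [a = a0], where [alpha] is the identity, or [b = b0], where the equality is
   the definition of [alpha]. *)
have tauE : tau (a :: w) b z = beta w b (alpha (a :: w) z).
  rewrite /beta /=; case: (cP w _ _ _ Fawb) => [|->|->]; last by rewrite tauVK.
    by apply: F_rcons; apply: F_cons Fawb.
  by rewrite tauK.
by rewrite tauE.
Qed.

(** Connectedness: from any [a :: w] the letter [b0] leads to the same vertex, so [P (a :: w)] does
    not depend on [a]. The family descends to shorter words, down to the empty one. *)
Lemma invariant_family (G : Type) (mul : G -> A -> G) n (P : seq A -> G -> Prop) :
  (forall v b g, size v = n -> F (rcons v b) ->
     P v g <-> P (behead (rcons v b)) (mul g b)) ->
  exists2 P0 : G -> Prop, forall v g, size v = n -> F v -> P v g <-> P0 g &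
    forall b g, P0 g <-> P0 (mul g b).
Proof.
elim: n P => [|n IH] P Pstep.
  exists (P [::]) => [[|//] g _ _ //|b g].
  exact: (Pstep [::] b g erefl (F_letter b)).
pose P1 w g := exists2 a, F (a :: w) & P (a :: w) g.
have P1E a w g : size w = n -> F (a :: w) -> P (a :: w) g <-> P1 w g.
  move=> sw Fa; split=> [|[a' Fa' Pa']]; first by exists a.
  have [_ [b0 [b0P _]]] := F_tree (F_cons Fa).
  have sw' c : size (c :: w) = n.+1 by rewrite /= sw.
  have := Pstep (a :: w) b0 g (sw' a) (b0P _ Fa) => /= ->.
  by have := Pstep (a' :: w) b0 g (sw' a') (b0P _ Fa') => /= <-.
have [w b g sw Fwb|P0 P0E P0b] := IH P1; last first.
  by exists P0 => // -[//|a w] g [sw] Faw; rewrite P1E // P0E //; apply: F_cons Faw.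
have [a Fa] := F_left Fwb; have sv : size (a :: w) = n.+1 by rewrite /= sw.
have Faw : F (a :: w) by apply: (@F_rcons (a :: w) b).
rewrite -(P1E a) // (Pstep _ b g sv Fa) /=.
have : size (rcons w b) = n.+1 by rewrite size_rcons sw.
by case: (rcons w b) Fwb => // a' w' Fw' [sw']; rewrite P1E.
Qed.

(** * The twisted action attached to a bifix code *)

Variable X : seq A -> Prop.
Hypothesis bX : bifix_code X.
Notation K := (rword (seq A)).

Definition read b (uk : seq A * K) : seq A * K :=
  if `[< X (rcons uk.1 b) >] then ([::], rpush (rcons uk.1 b, true) uk.2)
  else (rcons uk.1 b, uk.2).

Lemma base_point_indep (T : Type) (rho : A -> T -> T) n (h : seq A -> seq A * K -> T) :
  (forall b, injective (rho b)) ->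
  (forall a w b u k, n = (size w).+1 -> F (a :: rcons w b) -> u \in tails X w ->
     h (rcons w b) (read b (u, k)) = rho b (h (a :: w) (u, k))) ->
  forall v v' k, size v = n -> size v' = n -> F v -> F v' ->
    h v ([::], k) = h v' ([::], k).
Proof.
move=> rhoI; elim: n h => [|n IH] h hstep; first by move=> [|//] [|//].
have {}hstep a w b u k : size w = n -> F (a :: rcons w b) -> u \in tails X w ->
     h (rcons w b) (read b (u, k)) = rho b (h (a :: w) (u, k)).
  by move=> sw; apply: hstep; rewrite sw.
have indep a a' w u k : size w = n -> F (a :: w) -> F (a' :: w) -> u \in tails X w ->
    h (a :: w) (u, k) = h (a' :: w) (u, k).
  move=> sw Fa Fa' uw; have [_ [b0 [b0P _]]] := F_tree (F_cons Fa).
  apply: (rhoI b0); rewrite -!hstep //; exact: b0P.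
have [c cP] : {c : seq A -> A & forall w, F w -> F (c w :: w)}.
  apply: (@choice _ _ (fun w c => F w -> F (c :: w))) => w.
  case: (EM (F w)) => [/F_left[a Fa]|nF]; first by exists a.
  by have [a _] := F_left F_nil; exists a.
move=> [//|a w] [//|a' w'] k [sw] [sw'] Fa Fa'.
have Fw := F_cons Fa; have Fw' := F_cons Fa'.
rewrite (indep a (c w)) ?(indep a' (c w')) ?nil_in_tails //; try exact: cP.
apply: (IH (fun w => h (c w :: w))) => // {a a' w w' sw sw' Fa Fa' Fw Fw' k}.
move=> a w b u k sw Fawb uw.
have Faw : F (a :: w) by apply: (@F_rcons (a :: w) b).
have Fc : F (c (a :: rcons w b) :: a :: rcons w b) by apply: cP.
have Fc' : F (c (a :: rcons w b) :: a :: w) by apply: (@F_rcons (_ :: a :: w) b).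
have readE : (read b (u, k)).1 \in tails X (rcons w b).
  rewrite /read; case: asboolP => [_|nX] /=; first exact: nil_in_tails.
  exact: tails_rcons.
case: (read b (u, k)) readE (hstep (c (a :: rcons w b)) (a :: w) b u k) => u' k' u'w /= hE.
have saw : size (a :: w) = n by [].
have uaw : u \in tails X (a :: w) := tails_catl bX [:: a] uw.
rewrite (indep _ a _ u' k') ?size_rcons //; last by apply: cP; apply: F_cons Fawb.
by rewrite hE // (indep _ (c (a :: w))) //; apply: cP.
Qed.

Lemma emb_reduced u : reduced (rev (emb u)).
Proof.
rewrite /emb -map_rev; elim: (rev u) => [//|a s IH]; case: s IH => [//|b s] /= ->.
by rewrite xpair_eqE andbF.
Qed.

(* A word read from left to right is stored with its last letter on top. *)
Definition stack u : rword A := exist _ (rev (emb u)) (emb_reduced u).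

Lemma stack_rcons u b : rpush (b, true) (stack u) = stack (rcons u b).
Proof.
apply: val_inj => /=; have := emb_reduced (rcons u b); rewrite emb_rcons rev_rcons.
exact: push_reducedE.
Qed.

Lemma stack_inj : injective stack.
Proof. by move=> u v /(congr1 val) /= /(can_inj revK); apply: inj_map => a b []. Qed.

(** Edge labels must be bijections of the whole set, so the empty stack is traded back for [x] with
    an inverse generator. *)
Definition code_swap x (gk : rword A * K) : rword A * K :=
  if gk.1 == stack x then (stack [::], rpush (x, true) gk.2)
  else if gk.1 == stack [::] then (stack x, rpush (x, false) gk.2) else gk.

Lemma code_swapK x : x != [::] -> involutive (code_swap x).
Proof.
move=> nx [g k]; rewrite /code_swap /=; case: (altP (g =P stack x)) => [->|gx] /=.
  by rewrite (inj_eq stack_inj) eq_sym (negbTE nx) ?eqxx (rpushK (x, true)).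
case: (altP (g =P stack [::])) => [->|g0] /=; last by rewrite (negbTE gx) (negbTE g0).
by rewrite eqxx (rpushVK (x, true)).
Qed.

Lemma code_suffix_option : {f : seq A -> option (seq A) & forall e,
  if f e is Some x then X x /\ exists t, e = t ++ x else forall x t, X x -> e <> t ++ x}.
Proof.
apply: (@choice _ _ (fun e o => if o is Some x then X x /\ exists t, e = t ++ x
                                else forall x t, X x -> e <> t ++ x)) => e.
case: (EM (exists x, X x /\ exists t, e = t ++ x)) => [[x h]|h]; first by exists (Some x).
by exists None => x t Xx et; apply: h; exists x; split=> //; exists t.
Qed.

(* The free group of rank #|A| times the free group on the code carries, along each
   edge, the bijection "append the letter, then trade a completed code word for a
   generator". *)
Lemma twisted_action n v0 : size v0 = n -> F v0 ->
  exists (T : Type) (act : fletter A -> T -> T) (base : K -> T),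
  [/\ forall l, cancel (act l) (act (finv_letter l)),
      forall x k, X x -> F x -> size x <= n ->
        actw act (base k) (emb x) = base (rpush (x, true) k) &
      forall u u' k k', u \in tails X v0 -> u' \in tails X v0 ->
        actw act (base k) (emb u) = actw act (base k') (emb u') -> u = u' /\ k = k'].
Proof.
move=> sv0 Fv0; have [f fP] := code_suffix_option.
pose sw e := if f e is Some x then code_swap x else id.
have swK e : involutive (sw e).
  rewrite /sw; case: (f e) (fP e) => [x [Xx _]|_]; last by [].
  by apply: code_swapK; apply/eqP => x0; apply: (code_nonempty bX); rewrite -x0.
pose tau v b (gk : rword A * K) := sw (rcons v b) (rpush (b, true) gk.1, gk.2).
pose tau' v b gk := (rpush (b, false) (sw (rcons v b) gk).1, (sw (rcons v b) gk).2).
have tauK v b : cancel (tau v b) (tau' v b).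
  by move=> [g k]; rewrite /tau /tau' swK /= (rpushK (b, true)).
have tauVK v b : cancel (tau' v b) (tau v b).
  move=> gk; rewrite /tau /tau' /= (rpushVK (b, true)) -[RHS](swK (rcons v b)).
  by case: (sw _ gk).
have [th [rho [rho' [thI rhoK rhoVK thP]]]] := gauge n tauK tauVK.
pose st (uk : seq A * K) := (stack uk.1, uk.2).
(* On tails the label of an edge is [read]: the code word ending the edge, if any, is either
   [rcons u b] or different from it, and then the swap does nothing. *)
have thread a w b u k : n = (size w).+1 -> F (a :: rcons w b) -> u \in tails X w ->
    th (rcons w b) (st (read b (u, k))) = rho b (th (a :: w) (st (u, k))).
  move=> sw' Fawb uw; rewrite -thP //; congr (th _ _).
  rewrite /tau /= stack_rcons /sw /read /=.
  have [[t et] _] := mem_tails bX _ _ uw.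
  case: (f _) (fP (a :: rcons w b)) => [x [Xx [s es]]|nX]; case: asboolP => Xub.
  - have -> : x = rcons u b.
      by apply: (code_suffix_inj bX (t := s) (t' := a :: t) Xx Xub); rewrite -es et rcons_cat.
    by rewrite /code_swap /= eqxx.
  - rewrite /code_swap /= !(inj_eq stack_inj); case: eqP => [e|_]; first by rewrite e in Xub.
    by case: (u).
  - by case: (nX (rcons u b) (a :: t)); rewrite // et rcons_cat.
  - by [].
have indep := base_point_indep (h := fun v uk => th v (st uk)) (fun b => can_inj (rhoK b)) thread.
pose act (l : fletter A) := if l.2 then rho l.1 else rho' l.1.
have actK l : cancel (act l) (act (finv_letter l)).
  by case: l => b []; [exact: rhoK | exact: rhoVK].
pose base k := th v0 (st ([::], k)).
(* The base point is the same at every vertex, so the start may be chosen to make the reading of [y]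
   end at [t ++ y]; no code word is completed on the way. *)
have run y t k : size (t ++ y) = n -> F (t ++ y) -> avoids_prefix X y ->
    actw act (base k) (emb y) = th (t ++ y) (st (y, k)).
  elim/last_ind: y t => [|y b IH] t; first by rewrite cats0 => st' Ft _; apply: indep.
  rewrite -rcons_cat size_rcons => sn /F_left[a Fa] hy.
  have hy' : avoids_prefix X y by move: hy; rewrite -cats1; apply: avoids_prefix_catl.
  have nX : ~ X (rcons y b) by move/asboolP: hy => /(_ (rcons y b) [::]); apply; rewrite cats0.
  have Faty : F (a :: (t ++ y)) by apply: (@F_rcons (a :: (t ++ y)) b).
  rewrite emb_rcons /actw foldl_rcons -/(actw _ _ _) (IH (a :: t)) //.
  rewrite /act /= -thread //; last by apply/mem_tails => //; split=> //; exists t.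
  by rewrite /read; case: asboolP.
exists (rword A * K)%type, act, base; split=> //.
- move=> x k Xx Fx sx; case/lastP: x Xx Fx sx => [/(code_nonempty bX)//|y b] Xyb Fyb sx.
  have [t st' Fyt] := F_extend_left (n - size (rcons y b)) Fyb.
  have sn : size (t ++ rcons y b) = n by rewrite size_cat st' subnK.
  have hy := avoids_prefix_code bX Xyb.
  rewrite -rcons_cat size_rcons in Fyt sn; have [a Fa] := F_left Fyt.
  have Faty : F (a :: (t ++ y)) by apply: (@F_rcons (a :: (t ++ y)) b).
  rewrite emb_rcons /actw foldl_rcons -/(actw _ _ _) (run _ (a :: t)) //.
  rewrite /act /= -thread //; last by apply/mem_tails => //; split=> //; exists t.
  rewrite /read; case: asboolP => // _; apply: indep => //.
  by rewrite size_rcons.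
- move=> u u' k k' uv uv'.
  have [[t et] hu] := mem_tails bX _ _ uv; have [[t' et'] hu'] := mem_tails bX _ _ uv'.
  rewrite (run _ t) -?et // (run _ t') -?et' // => /thI e.
  by split; [apply: stack_inj (congr1 fst e) | apply: (congr1 snd e)].
Qed.

(** * Freeness, and separation of tails by cosets *)

Hypothesis XF : subset_of X F.
Notation H := (gen_subgroup X).

Lemma xreduced_rev (l : seq (seq A * bool)) : xreduced l -> reduced (rev l).
Proof.
elim/last_ind: l => [//|l p IH] red; rewrite rev_rcons.
have /IH {IH} : xreduced l.
  move=> i lti; have := red i; rewrite size_rcons !nth_rcons lti (ltnW lti).
  by apply; apply: ltnW.
case/lastP: l red => [//|l p'] red; rewrite rev_rcons => red'.
rewrite -[reduced _]/((p' != flip p) && reduced (p' :: rev l)) red' andbT.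
have := red (size l); rewrite !nth_rcons !size_rcons !ltnSn !ltnn !eqxx.
move=> /(_ isT) h; apply/eqP => e; apply: h.
by rewrite e.
Qed.

Lemma actw_generators n (T : Type) (act : fletter A -> T -> T) (base : K -> T)
    (l : seq (seq A * bool)) k :
  (forall c, cancel (act c) (act (finv_letter c))) ->
  (forall x k, X x -> F x -> size x <= n ->
        actw act (base k) (emb x) = base (rpush (x, true) k)) ->
  (forall p, p \in l -> X p.1) -> (forall p, p \in l -> size p.1 <= n) ->
  actw act (base k) (flatten (map (@sgn_elt A) l)) = base (foldl (fun r p => rpush p r) k l).
Proof.
move=> actK actX; elim: l k => [//|[x e] l IH] k lX ln /=; rewrite actw_cat.
have Xx := lX _ (mem_head _ _); have lex := ln _ (mem_head _ _).
have lX' p : p \in l -> X p.1 by move=> pl; apply: lX; rewrite inE pl orbT.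
have ln' p : p \in l -> size p.1 <= n by move=> pl; apply: ln; rewrite inE pl orbT.
case: e {lX ln} Xx lex => /= Xx lex; rewrite /sgn_elt /=.
  by rewrite actX ?IH //; apply: XF.
(* For an inverse generator, [k] is rewritten as [x] pushed on [x^-1] pushed on [k], and the action
   of [x] is undone. *)
rewrite -IH // -{1}(rpushVK (x, true) k) -actX ?actwK //.
exact: XF.
Qed.

(** The twisted action controls only code words of length at most [n], and [X] may be infinite, so
    [n] is chosen after the product [l]. *)
Lemma letters_bounded (l : seq (seq A * bool)) m :
  exists2 n, m <= n & forall p, p \in l -> size p.1 <= n.
Proof.
exists (m + \max_(p <- l) size p.1); first exact: leq_addr.
by move=> p pl; apply: leq_trans (leq_addl _ _); apply: leq_bigmax_seq.
Qed.

(** A product equal to 1 fixes the base point, hence its record is empty; but the record of a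
    reduced product is its reversal. *)
Lemma bifix_free : free_set X.
Proof.
move=> l lX /xreduced_rev red e; have [n _ ln] := letters_bounded l 0.
have [v0 sv0] := F_extend_left n F_nil; rewrite cats0 => Fv0.
have [T [act [base [actK actX actI]]]] := twisted_action sv0 Fv0.
have := actw_generators (rnil _) actK actX lX ln; rewrite (actw_feq _ _ e) //.
move=> /(actI [::] [::] _ _ (nil_in_tails bX _) (nil_in_tails bX _))[_ /(congr1 val)].
by rewrite foldl_rpush_rev ?cats0 //= => /esym /(congr1 rev); rewrite revK.
Qed.

(** An element of [H] only changes the record at the base point, so [u] and [u'] move two base
    points to the same place. *)
Lemma tails_coset_inj w u u' : F w -> u \in tails X w -> u' \in tails X w ->
  H (emb u ++ finv (emb u')) -> u = u'.
Proof.
move=> Fw uw uw' [l [lX e]]; have [n le_wn ln] := letters_bounded l (size w).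
have [z sz Fv0] := F_extend_left (n - size w) Fw.
have sv0 : size (z ++ w) = n by rewrite size_cat sz subnK.
have [T [act [base [actK actX actI]]]] := twisted_action sv0 Fv0.
have := actw_generators (rnil _) actK actX lX ln; rewrite -(actw_feq _ _ e) // actw_cat.
move=> /(congr1 (fun t => actw act t (emb u'))).
rewrite -{2}(finvK (emb u')) actwK // => /actI[] //; exact: tails_catl.
Qed.

Lemma tails_le_index w d : has_index H d -> F w -> size (tails X w) <= d.
Proof.
move=> [R [_ RP]] Fw; have [f fP] := choice (fun u => RP (emb u)).
rewrite -(size_map f) -(size_iota 0 d); apply: uniq_leq_size => [|_ /mapP[u _ ->]].
  rewrite map_inj_in_uniq ?tails_uniq // => u u' uw uw' e; apply: (tails_coset_inj Fw) => //.
  have [_ [hu _]] := fP u; have [_ [hu' _]] := fP u'.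
  by rewrite -e in hu'; apply: gen_coset_trans hu hu'.
by rewrite mem_iota; case: (fP u).
Qed.

(** * Index, maximality and finiteness from a bounded degree *)

Section FiniteDegree.
Hypothesis F_unif : forall w, F w ->
  exists N, forall v, F v -> N <= size v -> exists p s, v = p ++ w ++ s.
Variables (d : nat) (w0 : seq A).
Hypothesis Fw0 : F w0.
Hypothesis size_w0 : size (tails X w0) = d.
Hypothesis max_d : forall w, F w -> size (tails X w) <= d.

Lemma long_full : exists N, forall v, F v -> N <= size v -> size (tails X v) = d.
Proof.
have [N NP] := F_unif Fw0; exists N => v Fv leN; apply/eqP; rewrite eqn_leq max_d //=.
have [p [s ->]] := NP v Fv leN; rewrite -size_w0.
by apply: leq_trans (size_tails_catr bX _ s) _; apply: size_tails_catl.
Qed.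

Lemma full_code_suffix N v b : (forall v, F v -> N <= size v -> size (tails X v) = d) ->
  N <= size v -> F (rcons v b) -> exists2 u, u \in tails X v & X (rcons u b).
Proof.
move=> full leN Fvb; apply: contrapT => h.
have : size (tails X v) < size (tails X (rcons v b)).
  by apply: size_tails_ltn => // u uv Xub; apply: h; exists u.
by rewrite !full ?size_rcons ?ltnn ?(leqW leN) //; apply: F_rcons Fvb.
Qed.

Lemma full_tails_behead N e : (forall v, F v -> N <= size v -> size (tails X v) = d) ->
  N < size e -> F e -> tails X (behead e) =i tails X e.
Proof.
case: e => [//|c e] full leN Fe /=.
have [] // := @uniq_min_size _ (tails X e) (tails X (c :: e)).
- exact: tails_uniq.
- by move=> u; apply: (tails_catl bX [:: c]).
- by rewrite !full //; [apply: F_cons Fe | apply: ltnW].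
Qed.

Lemma coset_of_tail : exists2 v, F v /\ size (tails X v) = d &
  forall g, exists2 u, u \in tails X v & H (g ++ finv (emb u)).
Proof.
have [N full] := long_full.
have [v sv] := F_extend_left N F_nil; rewrite cats0 => Fv.
exists v => [|g]; first by rewrite full ?sv.
pose P v g := exists2 u, u \in tails X v & H (g ++ finv (emb u)).
pose mul (g : seq (fletter A)) b := rcons g (b, true).
have cancel_last g' u b :
    feq (mul g' b ++ finv (emb (rcons u b))) (g' ++ finv (emb u)).
  rewrite /mul emb_rcons -!cats1 finv_cat -catA; apply/feq_catl/feq_invKr.
(* Reading [b] sends a tail to its extension or, on completing a code word, to the empty tail;
   conversely the empty tail comes from a completed one by [full_code_suffix]. *)
have step v' b g' : size v' = N -> F (rcons v' b) ->
    P v' g' <-> P (behead (rcons v' b)) (mul g' b).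
  move=> sv' Fvb; have teq := full_tails_behead full _ Fvb.
  rewrite size_rcons sv' in teq; have {}teq := teq (ltnSn _); rewrite /P.
  split=> [[u uv Hu]|[u]]; last rewrite teq.
    have Hub : H (mul g' b ++ finv (emb (rcons u b))).
      by apply: gen_feq Hu; apply: esym; apply: cancel_last.
    case: (EM (X (rcons u b))) => Xub; last first.
      by exists (rcons u b) => //; rewrite teq; apply: tails_rcons.
    exists [::]; first by rewrite nil_in_tails.
    apply: gen_feq (gen_mul Hub (gen_emb Xub)); rewrite -catA; apply: feq_catl.
    exact: feq_invl.
  case/lastP: u => [_ Hg|u c].
    have [u uv Xub] : exists2 u, u \in tails X v' & X (rcons u b).
      by apply: full_code_suffix full _ Fvb; rewrite sv'.
    exists u => //; apply: gen_feq (cancel_last g' u b) _.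
    by rewrite cats0 in Hg; apply: gen_mul => //; apply/gen_inv/gen_emb.
  move=> ucv; have [[t]] := mem_tails bX _ _ ucv.
  rewrite -rcons_cat => /rcons_inj[_ ebc] _; rewrite -ebc in ucv * => Hu.
  exists u; first exact: tails_rcons_inv ucv.
  exact: gen_feq (cancel_last g' u b) Hu.
have [P0 P0E P0b] := invariant_family step.
have P0feq g1 g2 : feq g1 g2 -> P0 g1 -> P0 g2.
  move=> e /(P0E v) h; apply/(P0E v) => //; have [//|//|u uv Hu] := h.
  by exists u => //; apply: gen_feq Hu; apply: feq_catr.
apply/(P0E v) => //; elim/last_ind: g => [|g [b []] IH].
- apply/(P0E v) => //; exists [::]; [exact: nil_in_tails | exact: gen1].
- exact: (P0b b g).1 IH.
(* An inverse letter is handled by using the invariance backwards: appending [b] gives back [g]. *)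
- apply/(P0b b); apply: P0feq IH; rewrite /mul -!cats1 -catA -{1}(cats0 g).
  by apply: feq_catl; rewrite /feq /= !eqxx.
Qed.

Lemma degree_index : has_index H d.
Proof.
have [v [Fv sv] cosets] := coset_of_tail.
exists (map (@emb A) (tails X v)); split=> [|g]; first by rewrite size_map.
have [u uv Hu] := cosets g; have ltu : index u (tails X v) < d by rewrite -sv index_mem.
exists (index u (tails X v)); rewrite ltu (nth_map [::]) ?index_mem // nth_index //.
split=> //; split=> // j ltj; rewrite (nth_map [::]) ?sv // => Hj.
suff -> : u = nth [::] (tails X v) j by rewrite index_uniq ?sv ?tails_uniq.
apply: (tails_coset_inj Fv) => //; first by rewrite mem_nth ?sv.
exact: gen_coset_trans (gen_coset_sym Hu) (gen_coset_sym Hj).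
Qed.

(** A word of [Y], extended far to the left inside [F], also ends with a word of [X]; two words of
    [Y] ending the same word are equal. *)
Lemma degree_maximal : F_maximal_bifix F X.
Proof.
split=> //; split=> // Y bY YF XY y Yy; have [N full] := long_full.
case/lastP: y Yy => [/(code_nonempty bY)//|y b] Yyb.
have [z sz Fz] := F_extend_left N (YF _ Yyb).
have [||u uv Xub] := @full_code_suffix N (z ++ y) b full; rewrite ?rcons_cat //.
  by rewrite size_cat sz leq_addr.
have [[t et] _] := mem_tails bX _ _ uv.
rewrite -(@code_suffix_inj _ Y bY (rcons u b) (rcons y b) t z) //; first exact: XY.
by rewrite -!rcons_cat et.
Qed.

Lemma degree_finite : finite_set X.
Proof.
have [N full] := long_full.
(* If [y] were longer than [N], it would be a tail of itself and hence of the shorter [behead y]. *)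
have bound x : X x -> size x <= N.+1.
  case/lastP: x => [//|y b] Xyb; rewrite size_rcons ltnS leqNgt; apply/negP => ltN.
  have Fy : F y := F_rcons (XF Xyb).
  have : y \in tails X y.
    by apply/mem_tails => //; split; [exists [::] | apply: avoids_prefix_code Xyb].
  rewrite -(full_tails_behead full ltN Fy) => /(tails_size bX).
  by rewrite size_behead; case: (size y) ltN => // n _; rewrite ltnn.
exists [seq x <- [seq val t | t : N.+1.-bseq A] | `[< X x >]] => x.
rewrite mem_filter; split=> [Xx|/andP[/asboolP]//].
apply/andP; split; first exact/asboolP.
by apply/mapP; exists (Bseq (bound x Xx)); rewrite ?mem_enum.
Qed.

End FiniteDegree.
End Rauzy.

(** * Equivalence of index and degree *)

Theorem mainTheorem15 (A : finType) (F : seq A -> Prop) (d : nat) :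
  sturmian_set F -> 1 <= d ->
  forall X : seq A -> Prop, bifix_code X -> subset_of X F ->
    (free_basis_of_index X d <->
     finite_set X /\ F_maximal_bifix F X /\ F_degree F X d).
Proof.
move=> [x [ex Fx]] _ X bX XF.
have {Fx} eF : F = factor x by apply/funext => w; apply/propext.
rewrite {F}eF in XF *.
have F_nil : factor x [::] by exists 0.
have F_letter b : factor x [:: b].
  case: ex => _ [/(_ 0)[u [/size0nil -> ru]] full]; exact: (full [::] ru b).
have F_infix := @factor_infix A x.
have F_left := factor_left_ext ex.
have F_tree := extension_tree ex.
have F_unif := uniform_recurrence ex.
split=> [[_ index_d]|[_ [_ [[w0 [Fw0 /(num_parsesE bX) size_w0]] max_d]]]]; last first.
  have {}max_d w : factor x w -> size (tails X w) <= d.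
    by move=> Fw; apply: max_d Fw _; apply/num_parsesE.
  split; first exact: bifix_free XF.
  exact: (degree_index F_nil F_letter F_infix F_left F_tree bX XF F_unif Fw0 (esym size_w0) max_d).
(* The index bounds the number of tails, so a maximum [d'] exists; the subgroup then has index [d'],
   and uniqueness of the index gives [d' = d]. *)
pose occurs n := `[< exists2 w, factor x w & size (tails X w) = n >].
have ex_occurs : exists n, occurs n.
  by exists (size (tails X [::])); apply/asboolP; exists [::].
have le_d n : occurs n -> n <= d.
  by move=> /asboolP[w Fw <-]; apply: tails_le_index index_d Fw.
case: (ex_maxnP ex_occurs le_d) => d' /asboolP[w0 Fw0 size_w0] max_d'.
have {}max_d' w : factor x w -> size (tails X w) <= d'.
  by move=> Fw; apply: max_d'; apply/asboolP; exists w.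
have index_d' := degree_index F_nil F_letter F_infix F_left F_tree bX XF F_unif Fw0 size_w0 max_d'.
have dd' : d' = d by apply/eqP; rewrite eqn_leq !(has_index_le index_d, has_index_le index_d').
rewrite {d' index_d'}dd' in size_w0 max_d'.
split; first exact: (degree_finite F_infix bX XF F_unif Fw0 size_w0 max_d').
split; first exact: (degree_maximal F_infix F_left bX XF F_unif Fw0 size_w0 max_d').
split; first by exists w0; split=> //; apply/num_parsesE.
by move=> w n Fw /(num_parsesE bX) ->; apply: max_d'.
Qed.
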